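(* Let $S,T$ be as in the context and let $\mathrm{Pr}_T(x)$ be any $\Sigma_1$ provability predicate of $T$. Then: 1. $\mathsf{PA}+\mathrm{Con}^{\mathrm{H}}_T \vdash \mathrm{Con}^{\mathrm{S}}_T$. 2. If $T\vdash \mathrm{Con}^{\mathrm{S}}_T$, then $\mathrm{Pr}_T(x)$ satisfies $\mathbf{Ros}$. 3. If $\mathrm{Pr}_T(x)$ satisfies $\mathbf{Ros}$ and $\mathbf{C}$, then $T\vdash \mathrm{Con}^{\mathrm{S}}_T$. 4. If $\mathrm{Pr}_T(x)$ satisfies $\mathbf{Ros}$, then $T\vdash \mathrm{Con}^{\mathrm{L}}_T$. 5. If $T\vdash \mathrm{Con}^{\mathrm{L}}_T$ and $\mathrm{Pr}_T(x)$ satisfies $\mathbf{E}$, then $\mathrm{Pr}_T(x)$ satisfies $\mathbf{Ros}$.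
   Context: $\mathcal{L}_A=\{0,\mathsf{s},+,\times,\leq\}$ is the language of first-order arithmetic, and ''formula'' means $\mathcal{L}_A$-formula; $\ulcorner\varphi\urcorner$ is the numeral of the Gödel number of $\varphi$. $S$ and $T$ are consistent c.e. extensions of Peano Arithmetic $\mathsf{PA}$ in the language $\mathcal{L}_A$ such that $T$ is stronger than $S$ (every theorem of $S$ is a theorem of $T$; $S=T$ is allowed). A formula $\mathrm{Pr}_T(x)$ is a provability predicate of $T$ if for every formula $\varphi$: $T\vdash\varphi$ if and only if $S\vdash\mathrm{Pr}_T(\ulcorner\varphi\urcorner)$. A $\Sigma_1$ provability predicate is one that is a $\Sigma_1$ formula. $\mathrm{Fml}_{\mathcal{L}_A}(x)$ is a natural formula expressing ''$x$ is the Gödel number of an $\mathcal{L}_A$-formula'', and $\dot\neg\,x$ is a term for the primitive recursive function sending the Gödel number of $\varphi$ to that of $\neg\varphi$. Consistency statements: - $\mathrm{Con}^{\mathrm{H}}_T :\equiv \forall x\,(\mathrm{Fml}_{\mathcal{L}_A}(x)\land \mathrm{Pr}_T(x)\to\neg\,\mathrm{Pr}_T(\dot\neg\,x))$. - $\mathrm{Con}^{\mathrm{S}}_T := \{\mathrm{Pr}_T(\ulcorner\varphi\urcorner)\to\neg\,\mathrm{Pr}_T(\ulcorner\neg\varphi\urcorner)\mid \varphi \text{ a formula}\}$ (a set of sentences; a theory proves it if it proves every member). - $\mathrm{Con}^{\mathrm{L}}_T :\equiv \neg\,\mathrm{Pr}_T(\ulcorner 0=1\urcorner)$. Conditions on $\mathrm{Pr}_T(x)$: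 - $\mathbf{E}$: for all formulas $\varphi,\psi$, if $T\vdash\varphi\leftrightarrow\psi$, then $S\vdash\mathrm{Pr}_T(\ulcorner\varphi\urcorner)\leftrightarrow\mathrm{Pr}_T(\ulcorner\psi\urcorner)$. - $\mathbf{C}$: $S\vdash\mathrm{Pr}_T(\ulcorner\varphi\urcorner)\land\mathrm{Pr}_T(\ulcorner\psi\urcorner)\to\mathrm{Pr}_T(\ulcorner\varphi\land\psi\urcorner)$ for all formulas $\varphi,\psi$. - $\mathbf{Ros}$: for every formula $\varphi$, if $T\vdash\neg\varphi$, then $T\vdash\neg\,\mathrm{Pr}_T(\ulcorner\varphi\urcorner)$. *)

(* Defs.v *)
(* First-order arithmetic is deeply embedded, with de Bruijn indices. *)
From Stdlib Require Import List.
From Stdlib Require Vector Fin.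
Import ListNotations.

(** * Syntax of the language {0, s, +, *, <=} *)

Inductive term : Type :=
| Var (i : nat)
| Zero
| Succ (t : term)
| Add (t u : term)
| Mul (t u : term).

Inductive form : Type :=
| Eq (t u : term)
| Le (t u : term)
| Neg (A : form)
| And (A B : form)
| Or (A B : form)
| Imp (A B : form)
| All (A : form)
| Ex (A : form).

Definition Iff (A B : form) : form := And (Imp A B) (Imp B A).

Fixpoint subst_t (sigma : nat -> term) (t : term) : term :=
  match t with
  | Var i => sigma i
  | Zero => Zero
  | Succ t => Succ (subst_t sigma t)
  | Add t u => Add (subst_t sigma t) (subst_t sigma u)
  | Mul t u => Mul (subst_t sigma t) (subst_t sigma u)
  end.

Definition lift_t : term -> term := subst_t (fun i => Var (S i)).

Definition scons (t : term) (sigma : nat -> term) (i : nat) : term :=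
  match i with
  | O => t
  | S j => sigma j
  end.

Definition under (sigma : nat -> term) : nat -> term :=
  scons (Var 0) (fun i => lift_t (sigma i)).

Fixpoint subst (sigma : nat -> term) (A : form) : form :=
  match A with
  | Eq t u => Eq (subst_t sigma t) (subst_t sigma u)
  | Le t u => Le (subst_t sigma t) (subst_t sigma u)
  | Neg A => Neg (subst sigma A)
  | And A B => And (subst sigma A) (subst sigma B)
  | Or A B => Or (subst sigma A) (subst sigma B)
  | Imp A B => Imp (subst sigma A) (subst sigma B)
  | All A => All (subst (under sigma) A)
  | Ex A => Ex (subst (under sigma) A)
  end.

Definition lift : form -> form := subst (fun i => Var (S i)).

(* [inst A t] replaces variable 0 of A by t and lowers the other variables. *)
Definition inst (A : form) (t : term) : form := subst (scons t Var) A.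

Fixpoint fv_below_t (n : nat) (t : term) : Prop :=
  match t with
  | Var i => i < n
  | Zero => True
  | Succ t => fv_below_t n t
  | Add t u | Mul t u => fv_below_t n t /\ fv_below_t n u
  end.

Fixpoint fv_below (n : nat) (A : form) : Prop :=
  match A with
  | Eq t u | Le t u => fv_below_t n t /\ fv_below_t n u
  | Neg A => fv_below n A
  | And A B | Or A B | Imp A B => fv_below n A /\ fv_below n B
  | All A | Ex A => fv_below (S n) A
  end.

Definition sentence (A : form) : Prop := fv_below 0 A.

Fixpoint num (n : nat) : term :=
  match n with
  | O => Zero
  | S n => Succ (num n)
  end.

(** * Bounded and Sigma_1 formulas *)

Definition BAll (t : term) (A : form) : form := All (Imp (Le (Var 0) (lift_t t)) A).
Definition BEx (t : term) (A : form) : form := Ex (And (Le (Var 0) (lift_t t)) A).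

Inductive Delta0 : form -> Prop :=
| Delta0_Eq t u : Delta0 (Eq t u)
| Delta0_Le t u : Delta0 (Le t u)
| Delta0_Neg A : Delta0 A -> Delta0 (Neg A)
| Delta0_And A B : Delta0 A -> Delta0 B -> Delta0 (And A B)
| Delta0_Or A B : Delta0 A -> Delta0 B -> Delta0 (Or A B)
| Delta0_Imp A B : Delta0 A -> Delta0 B -> Delta0 (Imp A B)
| Delta0_BAll t A : Delta0 A -> Delta0 (BAll t A)
| Delta0_BEx t A : Delta0 A -> Delta0 (BEx t A).

Inductive Sigma1 : form -> Prop :=
| Sigma1_Delta0 A : Delta0 A -> Sigma1 A
| Sigma1_Ex A : Sigma1 A -> Sigma1 (Ex A).

(** * Classical first-order logic with equality *)

(* A theory is its set of axioms. *)
Definition theory := form -> Prop.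

(* [derives T G A]: natural deduction of A from the axioms T and the open
   hypotheses G.  Axioms are not lifted under binders: they are meant to be
   sentences. *)
Inductive derives (T : theory) : list form -> form -> Prop :=
| d_ax G A : T A -> derives T G A
| d_hyp G A : In A G -> derives T G A
| d_andI G A B : derives T G A -> derives T G B -> derives T G (And A B)
| d_andE1 G A B : derives T G (And A B) -> derives T G A
| d_andE2 G A B : derives T G (And A B) -> derives T G B
| d_orI1 G A B : derives T G A -> derives T G (Or A B)
| d_orI2 G A B : derives T G B -> derives T G (Or A B)
| d_orE G A B C : derives T G (Or A B) ->
    derives T (A :: G) C -> derives T (B :: G) C -> derives T G C
| d_impI G A B : derives T (A :: G) B -> derives T G (Imp A B)
| d_impE G A B : derives T G (Imp A B) -> derives T G A -> derives T G B
| d_negI G A B : derives T (A :: G) B -> derives T (A :: G) (Neg B) -> derives T G (Neg A)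
| d_negE G A B : derives T G A -> derives T G (Neg A) -> derives T G B
| d_dne G A : derives T G (Neg (Neg A)) -> derives T G A
| d_allI G A : derives T (map lift G) A -> derives T G (All A)
| d_allE G A t : derives T G (All A) -> derives T G (inst A t)
| d_exI G A t : derives T G (inst A t) -> derives T G (Ex A)
| d_exE G A B : derives T G (Ex A) -> derives T (A :: map lift G) (lift B) -> derives T G B
| d_eqI G t : derives T G (Eq t t)
| d_eqE G A t u : derives T G (Eq t u) -> derives T G (inst A t) -> derives T G (inst A u).

Definition proves (T : theory) (A : form) : Prop := derives T [] A.

Definition proves_all (T U : theory) : Prop := forall A, U A -> proves T A.

Definition consistent (T : theory) : Prop := ~ exists A, proves T A /\ proves T (Neg A).

Definition stronger (T S : theory) : Prop := forall A, proves S A -> proves T A.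

Definition extend (T : theory) (B : form) : theory := fun A => T A \/ A = B.

(** * Peano arithmetic *)

Fixpoint Alls (n : nat) (A : form) : form :=
  match n with
  | O => A
  | S n => All (Alls n A)
  end.

Definition ind_axiom (A : form) : form :=
  Imp (inst A Zero)
    (Imp (All (Imp A (subst (scons (Succ (Var 0)) (fun i => Var (S i))) A)))
      (All A)).

Inductive PA : theory :=
| PA_succ_nz : PA (All (Neg (Eq (Succ (Var 0)) Zero)))
| PA_succ_inj : PA (All (All (Imp (Eq (Succ (Var 1)) (Succ (Var 0))) (Eq (Var 1) (Var 0)))))
| PA_add_0 : PA (All (Eq (Add (Var 0) Zero) (Var 0)))
| PA_add_succ : PA (All (All (Eq (Add (Var 1) (Succ (Var 0))) (Succ (Add (Var 1) (Var 0))))))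
| PA_mul_0 : PA (All (Eq (Mul (Var 0) Zero) Zero))
| PA_mul_succ :
    PA (All (All (Eq (Mul (Var 1) (Succ (Var 0))) (Add (Mul (Var 1) (Var 0)) (Var 1)))))
| PA_le : PA (All (All (Iff (Le (Var 1) (Var 0)) (Ex (Eq (Add (Var 2) (Var 0)) (Var 1))))))
| PA_induction n A : sentence (Alls n (ind_axiom A)) -> PA (Alls n (ind_axiom A)).

(** * Goedel numbering *)

(* An injective polynomial pairing, larger than both arguments: since
   (a + b)^2 <= (a + b)^2 + a < (a + b + 1)^2, its value determines a + b and
   then a.  Being a polynomial, it is expressed by a term of the language. *)
Definition cpair (a b : nat) : nat := S ((a + b) * (a + b) + a).

Definition cpair_t (t u : term) : term := Succ (Add (Mul (Add t u) (Add t u)) t).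

Fixpoint code_t (t : term) : nat :=
  match t with
  | Var i => cpair 0 i
  | Zero => cpair 1 0
  | Succ t => cpair 2 (code_t t)
  | Add t u => cpair 3 (cpair (code_t t) (code_t u))
  | Mul t u => cpair 4 (cpair (code_t t) (code_t u))
  end.

Fixpoint code (A : form) : nat :=
  match A with
  | Eq t u => cpair 5 (cpair (code_t t) (code_t u))
  | Le t u => cpair 6 (cpair (code_t t) (code_t u))
  | Neg A => cpair 7 (code A)
  | And A B => cpair 8 (cpair (code A) (code B))
  | Or A B => cpair 9 (cpair (code A) (code B))
  | Imp A B => cpair 10 (cpair (code A) (code B))
  | All A => cpair 11 (code A)
  | Ex A => cpair 12 (code A)
  end.

Definition quote (A : form) : term := num (code A).

(* Evaluates to code (Neg A) when t evaluates to code A. *)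
Definition dot_neg (t : term) : term := cpair_t (num 7) t.

(** * The formula Fml(x): "x is the Goedel number of a formula"

   A finite set of numbers is coded, in the style of the beta function, by
   two numbers c, d: y is a member iff 1 + (y + 1) d divides c. *)

Definition mem_f (y c d : term) : form :=
  BEx c (Eq (Mul (Var 0) (Succ (Mul (Succ (lift_t y)) (lift_t d)))) (lift_t c)).

(* y is the code built with the given tag from one, resp. two, members of the
   set coded by c, d. *)
Definition step1 (tag : nat) (y c d : term) : form :=
  BEx y (And (mem_f (Var 0) (lift_t c) (lift_t d))
             (Eq (lift_t y) (cpair_t (num tag) (Var 0)))).

Definition step2 (tag : nat) (y c d : term) : form :=
  BEx y (BEx (lift_t y)
    (And (mem_f (Var 1) (lift_t (lift_t c)) (lift_t (lift_t d)))
    (And (mem_f (Var 0) (lift_t (lift_t c)) (lift_t (lift_t d)))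
         (Eq (lift_t (lift_t y)) (cpair_t (num tag) (cpair_t (Var 1) (Var 0))))))).

Definition term_step (y c d : term) : form :=
  Or (BEx y (Eq (lift_t y) (cpair_t (num 0) (Var 0))))
  (Or (Eq y (cpair_t (num 1) Zero))
  (Or (step1 2 y c d)
  (Or (step2 3 y c d)
      (step2 4 y c d)))).

(* Here c, d code a set of terms and e, d a set of formulas. *)
Definition form_step (y c e d : term) : form :=
  Or (step2 5 y c d)
  (Or (step2 6 y c d)
  (Or (step1 7 y e d)
  (Or (step2 8 y e d)
  (Or (step2 9 y e d)
  (Or (step2 10 y e d)
  (Or (step1 11 y e d)
      (step1 12 y e d))))))).

(* There are c, d, e such that x belongs to the set coded by e, d, and every
   y <= x in the set coded by c, d (resp. e, d) is the code of a term (resp.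
   formula) whose immediate constituents are in these sets.  The free variable
   x is Var 0; under the three quantifiers x, c, d, e are Var 3, 2, 1, 0. *)
Definition Fml : form :=
  Ex (Ex (Ex
    (And (mem_f (Var 3) (Var 0) (Var 1))
    (And (BAll (Var 3) (Imp (mem_f (Var 0) (Var 3) (Var 2))
                            (term_step (Var 0) (Var 3) (Var 2))))
         (BAll (Var 3) (Imp (mem_f (Var 0) (Var 1) (Var 2))
                            (form_step (Var 0) (Var 3) (Var 1) (Var 2)))))))).

(** * Computable enumerability *)

(* Partial recursive functions of n arguments. *)
Inductive recf : nat -> Type :=
| r_zero : recf 0
| r_succ : recf 1
| r_proj n (i : Fin.t n) : recf n
| r_comp k n (f : recf k) (g : Vector.t (recf n) k) : recf n
| r_prim n (f : recf n) (g : recf (S (S n))) : recf (S n)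
| r_min n (f : recf (S n)) : recf n.

Inductive eval : forall n, recf n -> Vector.t nat n -> nat -> Prop :=
| e_zero v : eval 0 r_zero v 0
| e_succ v : eval 1 r_succ v (S (Vector.hd v))
| e_proj n i v : eval n (r_proj n i) v (Vector.nth v i)
| e_comp k n f g v w y :
    (forall i, eval n (Vector.nth g i) v (Vector.nth w i)) ->
    eval k f w y -> eval n (r_comp k n f g) v y
| e_prim0 n f g v y :
    eval n f v y -> eval (S n) (r_prim n f g) (Vector.cons nat 0 n v) y
| e_primS n f g v m z y :
    eval (S n) (r_prim n f g) (Vector.cons nat m n v) z ->
    eval (S (S n)) g (Vector.cons nat m (S n) (Vector.cons nat z n v)) y ->
    eval (S n) (r_prim n f g) (Vector.cons nat (S m) n v) y
| e_min n f v m :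
    eval (S n) f (Vector.cons nat m n v) 0 ->
    (forall i, i < m -> exists z, eval (S n) f (Vector.cons nat i n v) (S z)) ->
    eval n (r_min n f) v m.

Definition ce (X : nat -> Prop) : Prop :=
  exists f : recf 1, forall x,
    X x <-> exists y, eval 1 f (Vector.cons nat x 0 (Vector.nil nat)) y.

Definition ce_theory (T : theory) : Prop := ce (fun n => exists A, T A /\ code A = n).

Definition consistent_ce_extension_of_PA (T : theory) : Prop :=
  (forall A, T A -> sentence A) /\ ce_theory T /\ stronger T PA /\ consistent T.

(** * Provability predicates, consistency statements and conditions

   A formula P with at most Var 0 free stands for Pr_T(x). *)

Definition provability_predicate (S T : theory) (P : form) : Prop :=
  fv_below 1 P /\ forall A, proves T A <-> proves S (inst P (quote A)).

(* As P has at most Var 0 free, the lowering done by [inst] is immaterial under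
   the quantifier: inst P (dot_neg (Var 0)) is Pr_T(neg x) for the bound x. *)
Definition ConH (P : form) : form :=
  All (Imp (And Fml P) (Neg (inst P (dot_neg (Var 0))))).

Definition ConS (P : form) : theory := fun B =>
  exists A, B = Imp (inst P (quote A)) (Neg (inst P (quote (Neg A)))).

Definition ConL (P : form) : form := Neg (inst P (quote (Eq Zero (Succ Zero)))).

Definition cond_E (S T : theory) (P : form) : Prop :=
  forall A B, proves T (Iff A B) ->
    proves S (Iff (inst P (quote A)) (inst P (quote B))).

Definition cond_C (S : theory) (P : form) : Prop :=
  forall A B, proves S
    (Imp (And (inst P (quote A)) (inst P (quote B))) (inst P (quote (And A B)))).

Definition cond_Ros (T : theory) (P : form) : Prop :=
  forall A, proves T (Neg A) -> proves T (Neg (inst P (quote A))).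

(* Main.v *)
(** Items 2-5 are propositional manipulations inside [T].  Item 1 is the one that
    needs arithmetic: to specialise [ConH] to a formula [A], PA must prove
    [Fml (quote A)].  This follows from Sigma_1-completeness of PA, once
    [Fml (quote A)] is seen to be true: with [n := code A] and [d := n!], the numbers
    [1 + (y + 1) d] for [y <= n] are pairwise coprime, so the products of those
    whose [y] is the code of a term, resp. of a formula, are the required [c] and [e]. *)
From Stdlib Require Import List Arith Lia Factorial Classical.
Require Import Defs.
Import ListNotations.

(** * Substitution *)

Lemma subst_t_ext sigma tau t :
  (forall i, sigma i = tau i) -> subst_t sigma t = subst_t tau t.
Proof. intros H; induction t; cbn; congruence. Qed.

Lemma subst_ext A : forall sigma tau,
  (forall i, sigma i = tau i) -> subst sigma A = subst tau A.
Proof.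
  assert (Hu : forall sigma tau, (forall i, sigma i = tau i) ->
    forall i, under sigma i = under tau i).
  { intros sigma tau H [|i]; cbn; [reflexivity | now rewrite H]. }
  induction A; cbn; intros sigma tau H; f_equal;
    auto using subst_t_ext.
Qed.

Lemma subst_t_ext_below n sigma tau t :
  (forall i, i < n -> sigma i = tau i) -> fv_below_t n t ->
  subst_t sigma t = subst_t tau t.
Proof.
  intros H; induction t; cbn; intros Ht; auto; try destruct Ht; f_equal; auto.
Qed.

(** Allows the values given to variables that do not occur free to be changed at will; needed for
    [Fml] and [P], whose only free variable is [Var 0]. *)
Lemma subst_ext_below A : forall n sigma tau,
  (forall i, i < n -> sigma i = tau i) -> fv_below n A ->
  subst sigma A = subst tau A.
Proof.
  assert (Hu : forall n sigma tau, (forall i, i < n -> sigma i = tau i) ->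
    forall i, i < S n -> under sigma i = under tau i).
  { intros n sigma tau H [|i] Hi; cbn; [reflexivity | rewrite H; [easy | lia]]. }
  induction A; cbn; intros n sigma tau H HA; f_equal;
    try (destruct HA); eauto using subst_t_ext_below.
Qed.

Lemma subst_t_comp sigma tau t :
  subst_t tau (subst_t sigma t) = subst_t (fun i => subst_t tau (sigma i)) t.
Proof. induction t; cbn; congruence. Qed.

Lemma subst_t_under_lift sigma t :
  subst_t (under sigma) (lift_t t) = lift_t (subst_t sigma t).
Proof. unfold lift_t; now rewrite !subst_t_comp. Qed.

Lemma subst_comp A : forall sigma tau,
  subst tau (subst sigma A) = subst (fun i => subst_t tau (sigma i)) A.
Proof.
  assert (Hu : forall sigma tau i, subst_t (under tau) (under sigma i) =
    under (fun j => subst_t tau (sigma j)) i).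
  { intros sigma tau [|i]; cbn; [reflexivity | apply subst_t_under_lift]. }
  induction A; cbn; intros sigma tau; f_equal; auto using subst_t_comp;
    rewrite IHA; now apply subst_ext.
Qed.

Lemma subst_t_Var t : subst_t Var t = t.
Proof. induction t; cbn; congruence. Qed.

Lemma subst_t_scons_lift t u sigma :
  subst_t (scons u sigma) (lift_t t) = subst_t sigma t.
Proof. unfold lift_t; now rewrite subst_t_comp. Qed.

Lemma inst_lift_t t u : subst_t (scons u Var) (lift_t t) = t.
Proof. now rewrite subst_t_scons_lift, subst_t_Var. Qed.

Lemma subst_t_num sigma n : subst_t sigma (num n) = num n.
Proof. induction n; cbn; congruence. Qed.

Lemma lift_t_num n : lift_t (num n) = num n.
Proof. apply subst_t_num. Qed.

(** * Derivations *)

(** The larger context is generalised in the induction because the quantifier rules lift it; axioms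
    are never lifted, so the theory can grow independently. *)
Lemma derives_weaken T G A : derives T G A ->
  forall U G', (forall B, T B -> U B) -> incl G G' -> derives U G' A.
Proof.
  induction 1; intros U G' HT HG.
  1: apply d_ax; auto.
  1: apply d_hyp; auto.
  all: try solve [econstructor; eauto using incl_map, incl_cons, incl_tl, in_eq].
Qed.

Lemma proves_derives T G A : proves T A -> derives T G A.
Proof. intros H; apply (derives_weaken T [] A H); auto using incl_nil_l. Qed.

Ltac hyp := apply d_hyp; cbn; tauto.

(** Taking the two instances as equations spares each use of [d_eqE] from exhibiting its goal as a
    literal [inst]. *)
Lemma inst_eq T G A t u B C : derives T G (Eq t u) ->
  inst A t = B -> inst A u = C -> derives T G B -> derives T G C.
Proof. intros H <- <-; now apply d_eqE. Qed.

Lemma eq_sym_d T G t u : derives T G (Eq t u) -> derives T G (Eq u t).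
Proof.
  intros H; apply (inst_eq T G (Eq (Var 0) (lift_t t)) t u (Eq t t)); auto using d_eqI;
    unfold inst; cbn; now rewrite inst_lift_t.
Qed.

Lemma eq_trans_d T G t u v :
  derives T G (Eq t u) -> derives T G (Eq u v) -> derives T G (Eq t v).
Proof.
  intros H1 H2; apply (inst_eq T G (Eq (lift_t t) (Var 0)) u v (Eq t u)); auto;
    unfold inst; cbn; now rewrite inst_lift_t.
Qed.

(** Lifting freezes the left side of the pattern, so that the replacement of [t] by [u] acts on the
    right side alone, starting from reflexivity. *)
Lemma eq_subst_t T G v t u : derives T G (Eq t u) ->
  derives T G (Eq (subst_t (scons t Var) v) (subst_t (scons u Var) v)).
Proof.
  intros H; apply (inst_eq T G (Eq (lift_t (subst_t (scons t Var) v)) v) t u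
    (Eq (subst_t (scons t Var) v) (subst_t (scons t Var) v))); auto using d_eqI;
    unfold inst; cbn; now rewrite inst_lift_t.
Qed.

Lemma eq_Succ T G t u : derives T G (Eq t u) -> derives T G (Eq (Succ t) (Succ u)).
Proof. intros H; apply (eq_subst_t T G (Succ (Var 0)) t u H). Qed.

Lemma eq_Add T G t t' u u' : derives T G (Eq t t') -> derives T G (Eq u u') ->
  derives T G (Eq (Add t u) (Add t' u')).
Proof.
  intros H1 H2; apply eq_trans_d with (Add t' u).
  - generalize (eq_subst_t T G (Add (Var 0) (lift_t u)) t t' H1); cbn.
    now rewrite !inst_lift_t.
  - generalize (eq_subst_t T G (Add (lift_t t') (Var 0)) u u' H2); cbn.
    now rewrite !inst_lift_t.
Qed.

Lemma eq_Mul T G t t' u u' : derives T G (Eq t t') -> derives T G (Eq u u') ->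
  derives T G (Eq (Mul t u) (Mul t' u')).
Proof.
  intros H1 H2; apply eq_trans_d with (Mul t' u).
  - generalize (eq_subst_t T G (Mul (Var 0) (lift_t u)) t t' H1); cbn.
    now rewrite !inst_lift_t.
  - generalize (eq_subst_t T G (Mul (lift_t t') (Var 0)) u u' H2); cbn.
    now rewrite !inst_lift_t.
Qed.

Lemma Le_eq T G t t' u u' : derives T G (Eq t t') -> derives T G (Eq u u') ->
  derives T G (Le t u) -> derives T G (Le t' u').
Proof.
  intros H1 H2 H.
  apply (inst_eq T G (Le (lift_t t') (Var 0)) u u' (Le t' u)); auto;
    try (unfold inst; cbn; now rewrite inst_lift_t).
  apply (inst_eq T G (Le (Var 0) (lift_t u)) t t' (Le t u)); auto;
    unfold inst; cbn; now rewrite inst_lift_t.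
Qed.

(** * Arithmetic in PA *)

Lemma PA_allE G A t B : PA (All A) -> inst A t = B -> derives PA G B.
Proof. intros H <-; apply d_allE, d_ax, H. Qed.

Lemma PA_allE2 G A t u B : PA (All (All A)) ->
  inst (subst (under (scons t Var)) A) u = B -> derives PA G B.
Proof.
  intros H <-; apply (d_allE PA G (subst (under (scons t Var)) A)).
  apply (d_allE PA G (All A)), d_ax, H.
Qed.

Ltac inst_simpl :=
  unfold inst; cbn; rewrite ?subst_t_under_lift, ?inst_lift_t; reflexivity.

Lemma succ_nz G t : derives PA G (Neg (Eq (Succ t) Zero)).
Proof. apply (PA_allE G _ t _ PA_succ_nz); inst_simpl. Qed.

Lemma succ_inj G t u :
  derives PA G (Eq (Succ t) (Succ u)) -> derives PA G (Eq t u).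
Proof.
  apply d_impE; apply (PA_allE2 G _ t u _ PA_succ_inj); inst_simpl.
Qed.

Lemma add_0 G t : derives PA G (Eq (Add t Zero) t).
Proof. apply (PA_allE G _ t _ PA_add_0); inst_simpl. Qed.

Lemma add_succ G t u : derives PA G (Eq (Add t (Succ u)) (Succ (Add t u))).
Proof. apply (PA_allE2 G _ t u _ PA_add_succ); inst_simpl. Qed.

Lemma mul_0 G t : derives PA G (Eq (Mul t Zero) Zero).
Proof. apply (PA_allE G _ t _ PA_mul_0); inst_simpl. Qed.

Lemma mul_succ G t u : derives PA G (Eq (Mul t (Succ u)) (Add (Mul t u) t)).
Proof. apply (PA_allE2 G _ t u _ PA_mul_succ); inst_simpl. Qed.

Lemma le_iff G t u :
  derives PA G (Iff (Le t u) (Ex (Eq (Add (lift_t t) (Var 0)) (lift_t u)))).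
Proof. apply (PA_allE2 G _ t u _ PA_le); inst_simpl. Qed.

Lemma le_intro G t u w : derives PA G (Eq (Add t w) u) -> derives PA G (Le t u).
Proof.
  intros H; eapply d_impE; [eapply d_andE2, le_iff|].
  apply d_exI with w; unfold inst; cbn; now rewrite !inst_lift_t.
Qed.

Lemma zero_or_succ G t :
  derives PA G (Or (Eq t Zero) (Ex (Eq (lift_t t) (Succ (Var 0))))).
Proof.
  set (A := Or (Eq (Var 0) Zero) (Ex (Eq (Var 1) (Succ (Var 0))))).
  assert (H : derives PA G (All A)).
  { eapply d_impE; [eapply d_impE|].
    (* [A] has only [Var 0] free, so its induction axiom is already a sentence and needs no closing
       quantifiers. *)
    - apply d_ax, (PA_induction 0 A); cbn; repeat split; lia.
    - apply d_orI1, d_eqI.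
    - apply d_allI, d_impI, d_orI2.
      apply d_exI with (Var 0); apply d_eqI. }
  apply (d_allE PA G A t H).
Qed.

Lemma num_add G a b : derives PA G (Eq (Add (num a) (num b)) (num (a + b))).
Proof.
  induction b; cbn.
  - rewrite Nat.add_0_r; apply add_0.
  - rewrite Nat.add_succ_r; eapply eq_trans_d; [apply add_succ | now apply eq_Succ].
Qed.

Lemma num_mul G a b : derives PA G (Eq (Mul (num a) (num b)) (num (a * b))).
Proof.
  induction b; cbn.
  - rewrite Nat.mul_0_r; apply mul_0.
  - rewrite Nat.mul_succ_r; eapply eq_trans_d; [apply mul_succ|].
    eapply eq_trans_d; [apply eq_Add; [exact IHb | apply d_eqI] | apply num_add].
Qed.

Lemma num_neq a : forall b G, a <> b -> derives PA G (Neg (Eq (num a) (num b))).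
Proof.
  induction a as [|a IH]; intros [|b] G H; cbn.
  - now contradiction H.
  - apply d_negI with (Eq (Succ (num b)) Zero); [apply eq_sym_d; hyp | apply succ_nz].
  - apply succ_nz.
  - apply d_negI with (Eq (num a) (num b)); [apply succ_inj; hyp | apply IH; lia].
Qed.

Lemma le_num G a b : a <= b -> derives PA G (Le (num a) (num b)).
Proof.
  intros H; apply le_intro with (num (b - a)).
  replace b with (a + (b - a)) at 2 by lia; apply num_add.
Qed.

(** * Case analysis below a numeral *)

Fixpoint eq_num_upto (n : nat) (t : term) : form :=
  match n with
  | O => Eq t Zero
  | S m => Or (Eq t (num n)) (eq_num_upto m t)
  end.

Lemma lift_eq_num_upto n t : lift (eq_num_upto n t) = eq_num_upto n (lift_t t).
Proof.
  induction n; cbn; [reflexivity|].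
  unfold lift in *; cbn; rewrite IHn; now rewrite subst_t_num.
Qed.

(** Write [t + w = n] and split on [w]. If [w] is zero then [t] equals [n]; if it is a successor,
    cancelling one [Succ] lowers the bound, which is absurd at zero and otherwise falls to the
    induction hypothesis. *)
Lemma le_num_cases n : forall G t,
  derives PA G (Le t (num n)) -> derives PA G (eq_num_upto n t).
Proof.
  induction n as [|n IH]; intros G t H;
    (eapply d_exE; [eapply d_impE; [eapply d_andE1, le_iff | exact H]|]);
    rewrite lift_eq_num_upto, lift_t_num;
    (eapply d_orE; [apply (zero_or_succ _ (Var 0)) | |]).
  (* The two goals with [w] zero, for a zero and for a successor bound, are served by the same
     equation. *)
  1, 3: assert (Ht : forall m G', derives PA (Eq (Var 0) Zero
      :: Eq (Add (lift_t t) (Var 0)) (num m) :: G') (Eq (lift_t t) (num m)))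
      by (intros m G'; eapply eq_trans_d; [apply eq_sym_d, add_0|];
          eapply eq_trans_d; [apply eq_Add; [apply d_eqI | apply eq_sym_d; hyp] | hyp]).
  - apply Ht.
  - apply d_orI1, Ht.
  - eapply d_exE; [hyp|]; rewrite lift_eq_num_upto; cbn.
    eapply d_negE; [|apply (succ_nz _ (Add (lift_t (lift_t t)) (Var 0)))].
    eapply eq_trans_d; [apply eq_sym_d, add_succ|].
    eapply eq_trans_d; [apply eq_Add; [apply d_eqI | apply eq_sym_d; hyp] | hyp].
  - eapply d_exE; [hyp|]; rewrite lift_eq_num_upto; cbn.
    apply d_orI2, IH, le_intro with (Var 0), succ_inj.
    eapply eq_trans_d; [apply eq_sym_d, add_succ|].
    eapply eq_trans_d; [apply eq_Add; [apply d_eqI | apply eq_sym_d; hyp]|].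
    (* The hypothesis [t + w = n + 1] has been lifted once more by the second existential
       elimination; the numeral is unaffected. *)
    apply d_hyp; do 2 right; left; unfold lift; cbn; now rewrite subst_t_num.
Qed.

(** The continuation accepts any context extending [G], since each case is reached under a different
    number of hypotheses left by the nested disjunctions. *)
Lemma eq_num_upto_elim n : forall G t C, derives PA G (eq_num_upto n t) ->
  (forall i G', i <= n -> incl G G' -> In (Eq t (num i)) G' -> derives PA G' C) ->
  derives PA G C.
Proof.
  induction n as [|n IH]; intros G t C H HC; cbn in H.
  - eapply d_impE; [|exact H].
    apply d_impI, (HC 0); auto using in_eq, incl_tl, incl_refl.
  - eapply d_orE; [exact H | |].
    + apply (HC (S n)); auto using in_eq, incl_tl, incl_refl.
    + apply IH with t; [hyp|].
      intros i G' Hi HG; apply HC; [lia|].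
      intros x Hx; apply HG, in_cons, Hx.
Qed.

Lemma le_num_elim n G t C : derives PA G (Le t (num n)) ->
  (forall i G', i <= n -> incl G G' -> In (Eq t (num i)) G' -> derives PA G' C) ->
  derives PA G C.
Proof. intros H; apply (eq_num_upto_elim n G t C), le_num_cases, H. Qed.

Lemma not_le_num G a b : b < a -> derives PA G (Neg (Le (num a) (num b))).
Proof.
  (* The choice of [0 = 1] is arbitrary: every case [a = i] with [i <= b] is refutable, so both it
     and its negation follow. *)
  intros H; apply d_negI with (Eq Zero (Succ Zero)).
  all: apply le_num_elim with b (num a); [hyp|].
  all: intros i G' Hi _ HG'; apply d_negE with (Eq (num a) (num i));
    [now apply d_hyp | apply num_neq; lia].
Qed.

(** * The standard model and Sigma_1-completeness *)

Definition ncons (k : nat) (rho : nat -> nat) (i : nat) : nat :=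
  match i with
  | O => k
  | S j => rho j
  end.

Fixpoint eval_t (rho : nat -> nat) (t : term) : nat :=
  match t with
  | Var i => rho i
  | Zero => 0
  | Succ t => S (eval_t rho t)
  | Add t u => eval_t rho t + eval_t rho u
  | Mul t u => eval_t rho t * eval_t rho u
  end.

Fixpoint sat (rho : nat -> nat) (A : form) : Prop :=
  match A with
  | Eq t u => eval_t rho t = eval_t rho u
  | Le t u => eval_t rho t <= eval_t rho u
  | Neg A => ~ sat rho A
  | And A B => sat rho A /\ sat rho B
  | Or A B => sat rho A \/ sat rho B
  | Imp A B => sat rho A -> sat rho B
  | All A => forall k, sat (ncons k rho) A
  | Ex A => exists k, sat (ncons k rho) A
  end.

Lemma eval_t_lift k rho t : eval_t (ncons k rho) (lift_t t) = eval_t rho t.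
Proof. induction t; cbn; try reflexivity; unfold lift_t in *; congruence. Qed.

Lemma eval_t_num rho n : eval_t rho (num n) = n.
Proof. induction n; cbn; congruence. Qed.

Lemma sat_BEx rho t A :
  sat rho (BEx t A) <-> exists k, k <= eval_t rho t /\ sat (ncons k rho) A.
Proof.
  cbn; split; intros [k Hk]; exists k; rewrite eval_t_lift in *; exact Hk.
Qed.

Lemma sat_BAll rho t A :
  sat rho (BAll t A) <-> forall k, k <= eval_t rho t -> sat (ncons k rho) A.
Proof.
  cbn; split; intros H k; specialize (H k); rewrite eval_t_lift in *; exact H.
Qed.

(** An environment read as a substitution. Since numerals are closed, instantiating a bound variable
    by a numeral amounts to extending the environment, which keeps PA and the standard model in
    step. *)
Definition nums (rho : nat -> nat) (i : nat) : term := num (rho i).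

Lemma eval_t_eq G rho t :
  derives PA G (Eq (subst_t (nums rho) t) (num (eval_t rho t))).
Proof.
  induction t; cbn.
  - apply d_eqI.
  - apply d_eqI.
  - now apply eq_Succ.
  - eapply eq_trans_d; [apply eq_Add; eassumption | apply num_add].
  - eapply eq_trans_d; [apply eq_Mul; eassumption | apply num_mul].
Qed.

Lemma subst_under_nums rho A :
  subst (under (nums rho)) A = subst (scons (Var 0) (nums rho)) A.
Proof.
  apply subst_ext; intros [|i]; cbn; [reflexivity | apply lift_t_num].
Qed.

Lemma inst_scons_nums rho A t :
  inst (subst (scons (Var 0) (nums rho)) A) t = subst (scons t (nums rho)) A.
Proof.
  unfold inst; rewrite subst_comp; apply subst_ext.
  intros [|i]; cbn; [reflexivity | apply subst_t_num].
Qed.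

Lemma subst_nums_ncons k rho A :
  subst (nums (ncons k rho)) A = subst (scons (num k) (nums rho)) A.
Proof. apply subst_ext; now intros [|i]. Qed.

Lemma inst_under_nums rho A k :
  inst (subst (under (nums rho)) A) (num k) = subst (nums (ncons k rho)) A.
Proof. now rewrite subst_under_nums, inst_scons_nums, subst_nums_ncons. Qed.

Lemma subst_lift_nums rho t :
  subst_t (under (nums rho)) (lift_t t) = subst_t (nums rho) t.
Proof.
  unfold lift_t; rewrite subst_t_comp; apply subst_t_ext.
  intros i; apply lift_t_num.
Qed.

(** Carries a proof about a numeral over to a term that equals it; below, the term is the variable
    of a bounded quantifier, known to be one of finitely many numerals. *)
Lemma eq_num_subst G rho A t i :
  derives PA G (Eq t (num i)) -> derives PA G (subst (nums (ncons i rho)) A) ->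
  derives PA G (subst (scons t (nums rho)) A).
Proof.
  intros H1 H2.
  apply (inst_eq PA G (subst (scons (Var 0) (nums rho)) A) (num i) t
    (subst (nums (ncons i rho)) A)); auto using eq_sym_d, inst_scons_nums.
  now rewrite inst_scons_nums, subst_nums_ncons.
Qed.

(** * Decision of bounded formulas in PA *)

Lemma bounded_search (P Q : nat -> Prop) (H : forall k, P k \/ Q k) n :
  (exists k, k <= n /\ P k) \/ (forall k, k <= n -> Q k).
Proof.
  induction n as [|n [[k [Hk HP]] | IH]].
  - destruct (H 0); [left; eauto | right; intros k Hk; now replace k with 0 by lia].
  - left; exists k; split; [lia | easy].
  - destruct (H (S n)); [left; eauto | right].
    intros k Hk; destruct (Nat.eq_dec k (S n)) as [-> | Hn]; [easy | apply IH; lia].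
Qed.

(** Both truth values are recorded because negation and implication exchange them. The quantifier
    over [G] makes the induction hypotheses usable under any open assumptions. *)
Definition decided (rho : nat -> nat) (A : form) : Prop :=
  (sat rho A /\ forall G, derives PA G (subst (nums rho) A)) \/
  (~ sat rho A /\ forall G, derives PA G (Neg (subst (nums rho) A))).

Lemma le_bound_eq G rho u t :
  derives PA G (Le u (subst_t (nums rho) t)) ->
  derives PA G (Le u (num (eval_t rho t))).
Proof. intros H; eapply Le_eq; [apply d_eqI | apply eval_t_eq | exact H]. Qed.

Lemma BAll_intro G rho t A :
  (forall k, k <= eval_t rho t ->
    forall G', derives PA G' (subst (nums (ncons k rho)) A)) ->
  derives PA G (subst (nums rho) (BAll t A)).
Proof.
  intros H; cbn; apply d_allI, d_impI.
  rewrite subst_lift_nums, subst_under_nums.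
  apply le_num_elim with (eval_t rho t) (Var 0); [apply le_bound_eq; hyp|].
  intros i G' Hi _ HG'; apply eq_num_subst with i; [now apply d_hyp | now apply H].
Qed.

Lemma BEx_elim G rho t A C :
  (forall k, k <= eval_t rho t ->
    forall G', derives PA G' (Neg (subst (nums (ncons k rho)) A))) ->
  derives PA G (subst (nums rho) (BEx t A)) -> derives PA G C.
Proof.
  intros H HE; cbn in HE; eapply d_exE; [exact HE|].
  rewrite subst_lift_nums, subst_under_nums.
  apply le_num_elim with (eval_t rho t) (Var 0);
    [apply le_bound_eq; eapply d_andE1; hyp|].
  intros i G' Hi HG HG'.
  apply d_negE with (subst (scons (Var 0) (nums rho)) A).
  - eapply d_andE2, d_hyp, HG, in_eq.
  - apply (eq_num_subst G' rho (Neg A) (Var 0) i); [now apply d_hyp | now apply H].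
Qed.

Lemma BEx_intro G rho t A k : k <= eval_t rho t ->
  derives PA G (subst (nums (ncons k rho)) A) ->
  derives PA G (subst (nums rho) (BEx t A)).
Proof.
  intros Hk H; cbn; apply d_exI with (num k).
  (* Convertible to the goal, but with [inst] kept around the body so that [inst_under_nums]
     applies. *)
  change (derives PA G (And (Le (num k)
    (subst_t (scons (num k) Var) (subst_t (under (nums rho)) (lift_t t))))
    (inst (subst (under (nums rho)) A) (num k)))).
  rewrite inst_under_nums, subst_t_under_lift, inst_lift_t.
  apply d_andI; [|exact H].
  eapply Le_eq; [apply d_eqI | apply eq_sym_d, eval_t_eq | now apply le_num].
Qed.

Lemma d_Neg_Imp T G A B :
  derives T G A -> derives T G (Neg B) -> derives T G (Neg (Imp A B)).
Proof.
  intros HA HB; apply d_negI with B.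
  - apply d_impE with A; [hyp|].
    apply (derives_weaken T G A HA); auto using incl_tl, incl_refl.
  - apply (derives_weaken T G _ HB); auto using incl_tl, incl_refl.
Qed.

(** Atoms are settled by computing both terms to numerals, connectives by truth tables, and a
    bounded quantifier by a finite search up to the value of its bound. *)
Lemma Delta0_decided A : Delta0 A -> forall rho, decided rho A.
Proof.
  unfold decided; induction 1 as [t u | t u | A _ IHA | A B _ IHA _ IHB | A B _ IHA _ IHB
    | A B _ IHA _ IHB | t A _ IHA | t A _ IHA]; intros rho.
  - destruct (Nat.eq_dec (eval_t rho t) (eval_t rho u)) as [E | E];
      [left | right]; split; auto; intros G; cbn.
    + eapply eq_trans_d; [apply eval_t_eq|]; rewrite E; apply eq_sym_d, eval_t_eq.
    + eapply d_negI; [|apply num_neq, E].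
      eapply eq_trans_d; [apply eq_sym_d, eval_t_eq|].
      eapply eq_trans_d; [|apply eval_t_eq]; hyp.
  - destruct (le_lt_dec (eval_t rho t) (eval_t rho u)) as [E | E];
      [left | right]; (split; [cbn; lia|]); intros G; cbn.
    + eapply Le_eq; [apply eq_sym_d, eval_t_eq | apply eq_sym_d, eval_t_eq | now apply le_num].
    + eapply d_negI; [|apply not_le_num, E].
      eapply Le_eq; [apply eval_t_eq | apply eval_t_eq | hyp].
  - destruct (IHA rho) as [[H1 H2] | [H1 H2]]; [right | left]; cbn; split; auto.
    intros G; eapply d_negI; [apply H2 | hyp].
  - destruct (IHA rho) as [[H1 H2] | [H1 H2]]; [destruct (IHB rho) as [[H3 H4] | [H3 H4]]|];
      [left | right | right]; cbn; (split; [tauto|]); intros G.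
    + now apply d_andI.
    + eapply d_negI; [eapply d_andE2; hyp | apply H4].
    + eapply d_negI; [eapply d_andE1; hyp | apply H2].
  - destruct (IHA rho) as [[H1 H2] | [H1 H2]]; [|destruct (IHB rho) as [[H3 H4] | [H3 H4]]];
      [left | left | right]; cbn; (split; [tauto|]); intros G.
    + now apply d_orI1.
    + now apply d_orI2.
    + apply d_negI with (subst (nums rho) A); [|apply H2].
      eapply d_orE; [hyp | hyp |].
      eapply d_negE; [|apply H4]; hyp.
  - destruct (IHB rho) as [[H3 H4] | [H3 H4]]; [|destruct (IHA rho) as [[H1 H2] | [H1 H2]]];
      [left | right | left]; cbn; (split; [tauto|]); intros G.
    + apply d_impI, H4.
    + now apply d_Neg_Imp.
    + apply d_impI; eapply d_negE; [|apply H2]; hyp.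
  (* The alternatives are swapped so that the search looks for a counterexample to the universal
     formula. *)
  - assert (IH : forall k, _ \/ _) by exact (fun k => proj1 (or_comm _ _) (IHA (ncons k rho))).
    destruct (bounded_search _ _ IH (eval_t rho t)) as [(k & Hk & H1 & H2) | H];
      [right | left]; rewrite sat_BAll; split.
    + auto.
    + intros G; apply d_negI with (subst (nums (ncons k rho)) A); [|apply H2].
      apply d_impE with (Le (num k) (subst_t (nums rho) t)).
      * assert (HB : derives PA (subst (nums rho) (BAll t A) :: G)
          (subst (nums rho) (BAll t A))) by hyp.
        apply (d_allE _ _ _ (num k)) in HB.
        change (derives PA (subst (nums rho) (BAll t A) :: G) (Imp (Le (num k)
          (subst_t (scons (num k) Var) (subst_t (under (nums rho)) (lift_t t))))
          (inst (subst (under (nums rho)) A) (num k)))) in HB.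
        now rewrite inst_under_nums, subst_t_under_lift, inst_lift_t in HB.
      * eapply Le_eq; [apply d_eqI | apply eq_sym_d, eval_t_eq | now apply le_num].
    + intros k Hk; now apply H.
    + intros G; apply BAll_intro; intros k Hk; now apply H.
  - destruct (bounded_search _ _ (fun k => IHA (ncons k rho)) (eval_t rho t))
      as [(k & Hk & H1 & H2) | H]; [left | right]; rewrite sat_BEx; split.
    + eauto.
    + intros G; now apply BEx_intro with k.
    + intros (k & Hk & H1); now apply (H k).
    + intros G; apply d_negI with (Eq Zero (Succ Zero));
        (apply BEx_elim with rho t A; [intros k Hk; now apply H | hyp]).
Qed.

(** Each unbounded existential is proved from the numeral of a witness in the standard model, until
    a true bounded formula remains. *)
Lemma Sigma1_complete A : Sigma1 A -> forall rho G,
  sat rho A -> derives PA G (subst (nums rho) A).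
Proof.
  induction 1 as [A HA | A _ IH]; intros rho G Hs.
  - destruct (Delta0_decided A HA rho) as [[_ H] | [H _]]; [apply H | contradiction].
  - destruct Hs as [k Hk]; apply d_exI with (num k).
    change (derives PA G (inst (subst (under (nums rho)) A) (num k))).
    rewrite inst_under_nums; now apply IH.
Qed.

(** * Truth of Fml at codes of formulas *)

Lemma divide_fact n k : 0 < k <= n -> Nat.divide k (fact n).
Proof.
  induction n as [|n IH]; intros Hk; [lia|].
  change (fact (S n)) with (S n * fact n).
  destruct (Nat.eq_dec k (S n)) as [-> | Hn].
  - apply Nat.divide_factor_l.
  - apply Nat.divide_mul_r, IH; lia.
Qed.

(* The modulus testing membership of [y] in a coded set, see [mem_f]. *)
Definition modulus (d y : nat) : nat := S (S y * d).

(** A common divisor [g] is coprime to [d], as it divides [1 + (y + 1) d]. It divides the difference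
    [d (z - y)], hence [z - y], which lies between 1 and [n] and so divides [d]. Thus [g] divides
    [d] and must be 1. *)
Lemma modulus_coprime n d y z :
  (forall k, 0 < k <= n -> Nat.divide k d) -> y < z <= n ->
  Nat.gcd (modulus d y) (modulus d z) = 1.
Proof.
  intros Hd Hyz; set (g := Nat.gcd _ _).
  assert (Hy : Nat.divide g (modulus d y)) by apply Nat.gcd_divide_l.
  assert (Hz : Nat.divide g (modulus d z)) by apply Nat.gcd_divide_r.
  assert (H1 : Nat.divide g d -> g = 1).
  { intros H; apply Nat.divide_1_r.
    apply Nat.divide_add_cancel_r with (S y * d); [now apply Nat.divide_mul_r|].
    replace (S y * d + 1) with (modulus d y) by (unfold modulus; lia); exact Hy. }
  apply H1.
  assert (Hgd : Nat.gcd g d = 1).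
  { apply Nat.divide_1_r, Nat.divide_add_cancel_r with (S y * d).
    - apply Nat.divide_mul_r, Nat.gcd_divide_r.
    - replace (S y * d + 1) with (modulus d y) by (unfold modulus; lia).
      eapply Nat.divide_trans; [apply Nat.gcd_divide_l | exact Hy]. }
  apply Nat.divide_trans with (z - y); [|apply Hd; lia].
  apply Nat.gauss with d; [|exact Hgd].
  apply Nat.divide_add_cancel_r with (modulus d y); [exact Hy|].
  replace (modulus d y + d * (z - y)) with (modulus d z); [exact Hz|].
  unfold modulus; nia.
Qed.

Lemma coprime_mul_r a b c : Nat.gcd a b = 1 -> Nat.gcd a c = 1 -> Nat.gcd a (b * c) = 1.
Proof.
  intros Hb Hc; apply Nat.divide_1_r; rewrite <- Hc.
  apply Nat.gcd_greatest; [apply Nat.gcd_divide_l|].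
  apply Nat.gauss with b; [apply Nat.gcd_divide_r|].
  apply Nat.divide_1_r; rewrite <- Hb; apply Nat.gcd_greatest; [|apply Nat.gcd_divide_r].
  eapply Nat.divide_trans; apply Nat.gcd_divide_l.
Qed.

(** The code is the product of the moduli of the members below [m]. Non-members are kept coprime to
    it, and not merely non-dividing, because coprimality survives multiplication by a further
    modulus. *)
Lemma set_code_upto (Q : nat -> Prop) n d m :
  (forall k, 0 < k <= n -> Nat.divide k d) -> m <= S n ->
  exists c, forall y, y <= n ->
    (y < m /\ Q y -> Nat.divide (modulus d y) c) /\
    (~ (y < m /\ Q y) -> Nat.gcd (modulus d y) c = 1).
Proof.
  intros Hd; induction m as [|m IH]; intros Hm.
  - exists 1; intros y _; split; [lia | intros _; apply Nat.divide_1_r, Nat.gcd_divide_r].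
  - destruct IH as [c Hc]; [lia|].
    (* [Q] is an arbitrary predicate, so excluded middle decides whether the modulus of [m] enters
       the product. *)
    destruct (classic (Q m)) as [HQ | HQ].
    + exists (c * modulus d m); intros y Hy; specialize (Hc y Hy).
      destruct (Nat.eq_dec y m) as [-> | Hn].
      * split; [intros _; apply Nat.divide_factor_r | intros []; auto].
      * split; intros H.
        -- apply Nat.divide_mul_l, Hc; split; [lia | easy].
        -- apply coprime_mul_r; [apply Hc; intros []; apply H; auto|].
           destruct (Nat.lt_total y m) as [? | [? | ?]]; [| lia | rewrite Nat.gcd_comm];
             apply modulus_coprime with n; auto; lia.
    + exists c; intros y Hy; specialize (Hc y Hy).
      assert (E : y < S m /\ Q y <-> y < m /\ Q y).
      { split; intros [H1 H2]; (split; [|exact H2]); [|lia].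
        destruct (Nat.eq_dec y m) as [-> | Hn]; [contradiction | lia]. }
      now rewrite E.
Qed.

Lemma set_code (Q : nat -> Prop) n :
  exists c, forall y, y <= n -> (Nat.divide (modulus (fact n) y) c <-> Q y).
Proof.
  destruct (set_code_upto Q n (fact n) (S n)) as [c Hc]; [apply divide_fact | lia |].
  exists c; intros y Hy; destruct (Hc y Hy) as [H1 H2]; split.
  - intros Hdiv; apply NNPP; intros HQ.
    assert (Hg : Nat.gcd (modulus (fact n) y) c = 1) by (apply H2; tauto).
    apply Nat.divide_gcd_iff in Hdiv.
    (* A modulus that divides [c] and is coprime to it would be 1, but [fact n > 0] makes it at
       least 2. *)
    assert (Hf := lt_O_fact n); unfold modulus in *; lia.
  - intros HQ; apply H1; split; [lia | exact HQ].
Qed.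

(** * Truth of the clauses of the formula [Fml] *)

Lemma sat_mem_f rho y c d : sat rho (mem_f y c d) <->
  Nat.divide (modulus (eval_t rho d) (eval_t rho y)) (eval_t rho c).
Proof.
  unfold mem_f; rewrite sat_BEx; cbn [sat eval_t].
  unfold modulus; split.
  - intros (k & _ & H); rewrite !eval_t_lift in H; exists k; now symmetry.
  (* The quotient respects the bound [c] in [mem_f] because the modulus is at least 1. *)
  - intros [k H]; exists k; rewrite !eval_t_lift; split; [nia | now symmetry].
Qed.

Lemma le_cpair_l a b : a <= cpair a b.
Proof. unfold cpair; nia. Qed.

Lemma le_cpair_r a b : b <= cpair a b.
Proof. unfold cpair; nia. Qed.

Lemma eval_cpair_t rho t u : eval_t rho (cpair_t t u) = cpair (eval_t rho t) (eval_t rho u).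
Proof. reflexivity. Qed.

Lemma sat_step1 rho tag y c d a :
  eval_t rho y = cpair tag a ->
  Nat.divide (modulus (eval_t rho d) a) (eval_t rho c) ->
  sat rho (step1 tag y c d).
Proof.
  intros Hy Ha; unfold step1; apply sat_BEx; exists a; split.
  - rewrite Hy; apply le_cpair_r.
  - split.
    + apply sat_mem_f; now rewrite !eval_t_lift.
    + cbn [sat]; now rewrite eval_cpair_t, eval_t_lift, eval_t_num.
Qed.

Lemma sat_step2 rho tag y c d a b :
  eval_t rho y = cpair tag (cpair a b) ->
  Nat.divide (modulus (eval_t rho d) a) (eval_t rho c) ->
  Nat.divide (modulus (eval_t rho d) b) (eval_t rho c) ->
  sat rho (step2 tag y c d).
Proof.
  assert (Hle := le_cpair_r tag (cpair a b)).
  assert (Hl := le_cpair_l a b); assert (Hr := le_cpair_r a b).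
  intros Hy Ha Hb; unfold step2.
  apply sat_BEx; exists a; split; [lia|].
  apply sat_BEx; exists b; rewrite eval_t_lift; split; [lia|].
  split; [|split].
  - apply sat_mem_f; now rewrite !eval_t_lift.
  - apply sat_mem_f; now rewrite !eval_t_lift.
  - cbn [sat]; now rewrite !eval_cpair_t, !eval_t_lift, eval_t_num.
Qed.

Lemma sat_Fml A rho : sat (ncons (code A) rho) Fml.
Proof.
  set (n := code A).
  destruct (set_code (fun y => exists t, code_t t = y) n) as [c Hc].
  destruct (set_code (fun y => exists B, code B = y) n) as [e He].
  (* The coded sets are all term codes and all formula codes up to [n], over the common parameter
     [n!]. Beyond [n] their content is uncontrolled, but [Fml] inspects only numbers up to [n]. *)
  exists c, (fact n), e; split; [|split].
  - apply sat_mem_f, He; [apply Nat.le_refl | now exists A].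
  - apply sat_BAll; intros y Hy Hm; change (y <= n) in Hy.
    (* Membership yields an actual term with code [y]; its head symbol selects the disjunct, and its
       constituents have codes at most [y], hence belong to the set. *)
    apply sat_mem_f, Hc in Hm; [|exact Hy]; destruct Hm as [t Ht]; change (code_t t = y) in Ht.
    assert (Hmem : forall u, code_t u <= y -> Nat.divide (modulus (fact n) (code_t u)) c).
    { intros u Hu; apply Hc; [lia | now exists u]. }
    unfold term_step; cbn [sat].
    destruct t as [i | | t | t u | t u]; cbn [code_t] in Ht.
    + left; apply sat_BEx; exists i; split; [|now symmetry].
      change (i <= y); rewrite <- Ht; apply le_cpair_r.
    + right; left; now symmetry.
    + do 2 right; left; apply sat_step1 with (code_t t); [now symmetry|].
      apply Hmem; rewrite <- Ht; apply le_cpair_r.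
    + do 3 right; left; apply sat_step2 with (code_t t) (code_t u); [now symmetry | |];
        apply Hmem; rewrite <- Ht; (eapply Nat.le_trans; [|apply le_cpair_r]);
        [apply le_cpair_l | apply le_cpair_r].
    + do 4 right; apply sat_step2 with (code_t t) (code_t u); [now symmetry | |];
        apply Hmem; rewrite <- Ht; (eapply Nat.le_trans; [|apply le_cpair_r]);
        [apply le_cpair_l | apply le_cpair_r].
  - apply sat_BAll; intros y Hy Hm; change (y <= n) in Hy.
    apply sat_mem_f, He in Hm; [|exact Hy]; destruct Hm as [B HB]; change (code B = y) in HB.
    assert (Hmem_t : forall u, code_t u <= y -> Nat.divide (modulus (fact n) (code_t u)) c).
    { intros u Hu; apply Hc; [lia | now exists u]. }
    assert (Hmem : forall C, code C <= y -> Nat.divide (modulus (fact n) (code C)) e).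
    { intros C HC; apply He; [lia | now exists C]. }
    assert (H1 : forall tag C, cpair tag (code C) = y ->
      Nat.divide (modulus (fact n) (code C)) e).
    { intros tag C HC; apply Hmem; rewrite <- HC; apply le_cpair_r. }
    assert (H2 : forall tag a b, cpair tag (cpair a b) = y -> a <= y /\ b <= y).
    { intros tag a b <-; assert (Hr := le_cpair_r tag (cpair a b)).
      assert (Hl := le_cpair_l a b); assert (Hr' := le_cpair_r a b); lia. }
    unfold form_step; cbn [sat].
    destruct B as [t u | t u | B | B C | B C | B C | B | B]; cbn [code] in HB.
    + left; apply sat_step2 with (code_t t) (code_t u);
        [now symmetry | | ]; apply Hmem_t, (H2 _ _ _ HB).
    + do 1 right; left; apply sat_step2 with (code_t t) (code_t u);
        [now symmetry | | ]; apply Hmem_t, (H2 _ _ _ HB).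
    + do 2 right; left; apply sat_step1 with (code B); [now symmetry | exact (H1 _ _ HB)].
    + do 3 right; left; apply sat_step2 with (code B) (code C);
        [now symmetry | | ]; apply Hmem, (H2 _ _ _ HB).
    + do 4 right; left; apply sat_step2 with (code B) (code C);
        [now symmetry | | ]; apply Hmem, (H2 _ _ _ HB).
    + do 5 right; left; apply sat_step2 with (code B) (code C);
        [now symmetry | | ]; apply Hmem, (H2 _ _ _ HB).
    + do 6 right; left; apply sat_step1 with (code B); [now symmetry | exact (H1 _ _ HB)].
    + do 7 right; apply sat_step1 with (code B); [now symmetry | exact (H1 _ _ HB)].
Qed.

(** Apart from the three leading existentials every quantifier is bounded, including the one
    expressing divisibility in [mem_f]. *)
Lemma Sigma1_Fml : Sigma1 Fml.
Proof. do 3 apply Sigma1_Ex; apply Sigma1_Delta0; repeat constructor. Qed.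

Lemma PA_proves_Fml G A : derives PA G (inst Fml (quote A)).
Proof.
  (* The default value 0 is harmless, [Var 0] being the only free variable of [Fml]. *)
  assert (E : inst Fml (quote A) = subst (nums (ncons (code A) (fun _ => 0))) Fml).
  { apply subst_ext_below with 1; [|cbn; lia].
    intros [|i] Hi; [reflexivity | lia]. }
  rewrite E; apply Sigma1_complete; [apply Sigma1_Fml | apply sat_Fml].
Qed.

(** * Consistency statements *)

(** [dot_neg] is a polynomial term, so PA evaluates its closed instance to the numeral of its value,
    which is [code (Neg A)]. *)
Lemma dot_neg_quote G A : derives PA G (Eq (dot_neg (quote A)) (quote (Neg A))).
Proof.
  assert (H := eval_t_eq G (fun _ => 0) (dot_neg (quote A))).
  unfold dot_neg in *; rewrite eval_cpair_t, eval_t_num in H.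
  unfold cpair_t, quote in *; cbn [subst_t] in H.
  rewrite !subst_t_num, eval_t_num in H; exact H.
Qed.

Lemma ConH_instance P A : fv_below 1 P ->
  inst (Imp (And Fml P) (Neg (inst P (dot_neg (Var 0))))) (quote A) =
  Imp (And (inst Fml (quote A)) (inst P (quote A))) (Neg (inst P (dot_neg (quote A)))).
Proof.
  intros HP; unfold inst; cbn [subst]; do 2 f_equal.
  rewrite subst_comp; apply subst_ext_below with 1; [|exact HP].
  intros [|i] Hi; [reflexivity | lia].
Qed.

(** Specialise [ConH] to [quote A], discharge the [Fml] premise by Sigma_1-completeness, and rewrite
    [dot_neg (quote A)] into [quote (Neg A)]. *)
Lemma ConH_proves_ConS P : fv_below 1 P -> proves_all (extend PA (ConH P)) (ConS P).
Proof.
  intros HP _ [A ->]; set (T := extend PA (ConH P)).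
  assert (HPA : forall G B, derives PA G B -> derives T G B).
  { intros G B H; apply (derives_weaken PA G B H); [now left | apply incl_refl]. }
  apply d_impI, d_negI with (inst P (dot_neg (quote A))).
  - apply d_eqE with (quote (Neg A)); [|hyp].
    apply eq_sym_d, HPA, dot_neg_quote.
  - apply d_impE with (And (inst Fml (quote A)) (inst P (quote A))).
    + rewrite <- ConH_instance by exact HP; apply d_allE, d_ax; now right.
    + apply d_andI; [apply HPA, PA_proves_Fml | hyp].
Qed.

Lemma PA_zero_neq_one G : derives PA G (Neg (Eq Zero (Succ Zero))).
Proof. now apply (num_neq 0 1). Qed.

Lemma proves_Iff_refuted T A B :
  proves T (Neg A) -> proves T (Neg B) -> proves T (Iff A B).
Proof.
  intros HA HB; apply d_andI; apply d_impI.
  - apply d_negE with A; [hyp | now apply proves_derives].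
  - apply d_negE with B; [hyp | now apply proves_derives].
Qed.

Theorem proposition2p6 (S T : theory) (P : form)
  (hS : consistent_ce_extension_of_PA S)
  (hT : consistent_ce_extension_of_PA T)
  (hTS : stronger T S)
  (hP : provability_predicate S T P)
  (hSigma1 : Sigma1 P) :
  proves_all (extend PA (ConH P)) (ConS P) /\
  (proves_all T (ConS P) -> cond_Ros T P) /\
  (cond_Ros T P -> cond_C S P -> proves_all T (ConS P)) /\
  (cond_Ros T P -> proves T (ConL P)) /\
  (proves T (ConL P) -> cond_E S T P -> cond_Ros T P).
Proof.
  destruct hT as (_ & _ & hPA & _), hP as [hfv hP].
  assert (h01 : proves T (Neg (Eq Zero (Succ Zero)))) by apply hPA, PA_zero_neq_one.
  split; [|split; [|split; [|split]]].
  - now apply ConH_proves_ConS.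
  - intros hCon A hA.
    (* Since [T] proves [Neg A], [S] and hence [T] prove that [Neg A] is provable; the consistency
       instance for [A] then contradicts the provability of [A]. *)
    apply d_negI with (inst P (quote (Neg A))).
    + now apply proves_derives, hTS, hP.
    + apply d_impE with (inst P (quote A)); [|hyp].
      apply proves_derives, hCon; now exists A.
  - intros hRos hC _ [A ->].
    (* By [cond_C], provability of [A] and of [Neg A] gives that of their conjunction, which [T]
       refutes, so [cond_Ros] applies to it. *)
    apply d_impI, d_negI with (inst P (quote (And A (Neg A)))).
    + eapply d_impE; [apply proves_derives, hTS, hC | apply d_andI; hyp].
    + apply proves_derives, hRos.
      apply d_negI with A; [eapply d_andE1 | eapply d_andE2]; hyp.
  - intros hRos; now apply hRos.
  - intros hCon hE A hA.
    (* [T] refutes both [A] and [0 = 1], hence proves them equivalent; [cond_E] then turns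
       provability of [A] into provability of [0 = 1], against [ConL]. *)
    apply d_negI with (inst P (quote (Eq Zero (Succ Zero)))); [|now apply proves_derives].
    eapply d_impE; [|hyp].
    eapply d_andE1, proves_derives, hTS, hE.
    now apply proves_Iff_refuted.
Qed.
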